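(* Let $p\ge 6$ be an even integer and let $k\ge 0$ be an integer. Then the lollipop $L(p,k)$ is determined by its spectrum, i.e. every graph cospectral with $L(p,k)$ is isomorphic to $L(p,k)$.
   Context: All graphs are finite and simple. The spectrum of a graph is the multiset of eigenvalues of its adjacency matrix; two graphs are cospectral if they have the same spectrum. The coalescence of a graph $G_1$ with distinguished vertex $v_1$ and a graph $G_2$ with distinguished vertex $v_2$ is the graph obtained from their disjoint union by identifying $v_1$ and $v_2$. $C_p$ is the cycle with $p$ vertices and $P_m$ the path with $m$ vertices. For $p\ge 3$ and $k\ge 1$, the lollipop $L(p,k)$ is the coalescence of $C_p$ (any distinguished vertex) and $P_{k+1}$ with a vertex of degree one as distinguished vertex (so $L(p,k)$ has $p+k$ vertices); by convention $L(p,0)=C_p$. *)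

(* Defs.v *)
From HB Require Import structures.
From mathcomp Require Import all_boot all_order all_algebra all_field.
From mathcomp Require Import finmap multiset.

Set Implicit Arguments.
Unset Strict Implicit.
Unset Printing Implicit Defensive.

Import GRing.Theory.

Record sgraph := SGraph {
  vertex :> finType;
  adj : rel vertex;
  adj_sym : symmetric adj;
  adj_irrefl : irreflexive adj }.

Definition isomorphic (G H : sgraph) : Prop :=
  exists2 f : G -> H, bijective f & forall x y, adj (f x) (f y) = adj x y.

Definition adjacency_mx (G : sgraph) : 'M[algC]_#|G| :=
  (\matrix_(i, j) (adj (enum_val i) (enum_val j))%:R)%R.

(* [closed_field_poly_normal] lists the roots of a polynomial with
   multiplicity, so each eigenvalue is counted with its algebraic multiplicity. *)
Definition spectrum (G : sgraph) : {mset algC}%mset :=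
  seq_mset (sval (closed_field_poly_normal (char_poly (adjacency_mx G)))).

Definition cospectral (G H : sgraph) : Prop := spectrum G = spectrum H.

Definition determined_by_spectrum (G : sgraph) : Prop :=
  forall H : sgraph, cospectral H G -> isomorphic H G.

Section Coalescence.
Variables (G1 G2 : sgraph) (v1 : G1) (v2 : G2).

(* The class {v1, v2} is represented by [inl v1]. *)
Definition coalescence_adj (a b : G1 + {y : G2 | y != v2}) : bool :=
  match a, b with
  | inl x, inl x' => adj x x'
  | inr y, inr y' => adj (val y) (val y')
  | inl x, inr y | inr y, inl x => (x == v1) && adj v2 (val y)
  end.

Lemma coalescence_adj_sym : symmetric coalescence_adj.
Proof. by move=> [x|y] [x'|y'] //=; apply: adj_sym. Qed.

Lemma coalescence_adj_irrefl : irreflexive coalescence_adj.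
Proof. by move=> [x|y] /=; apply: adj_irrefl. Qed.

Definition coalescence : sgraph :=
  SGraph coalescence_adj_sym coalescence_adj_irrefl.

End Coalescence.

(* [ordS i] is i + 1 modulo p.  The conjunct [i != j] only matters for p = 1;
   for p >= 3 this is the cycle on p vertices. *)
Definition cycle_adj (p : nat) (i j : 'I_p) : bool :=
  (i != j) && ((j == ordS i) || (i == ordS j)).

Lemma cycle_adj_sym p : symmetric (@cycle_adj p).
Proof. by move=> i j; rewrite /cycle_adj eq_sym orbC. Qed.

Lemma cycle_adj_irrefl p : irreflexive (@cycle_adj p).
Proof. by move=> i; rewrite /cycle_adj eqxx. Qed.

Definition cycle_graph (p : nat) : sgraph :=
  SGraph (@cycle_adj_sym p) (@cycle_adj_irrefl p).

Definition path_adj (m : nat) (i j : 'I_m) : bool :=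
  (j == i.+1 :> nat) || (i == j.+1 :> nat).

Lemma path_adj_sym m : symmetric (@path_adj m).
Proof. by move=> i j; rewrite /path_adj orbC. Qed.

Lemma path_adj_irrefl m : irreflexive (@path_adj m).
Proof. by move=> i; rewrite /path_adj orbb eqn_leq ltnn andbF. Qed.

Definition path_graph (m : nat) : sgraph :=
  SGraph (@path_adj_sym m) (@path_adj_irrefl m).

(* The distinguished vertex v of the cycle is kept as a parameter, since any
   choice is allowed; the end [ord0] of the path has degree one for k >= 1. *)
Definition lollipop (p k : nat) (v : cycle_graph p) : sgraph :=
  if k is k'.+1
  then coalescence v (ord0 : path_graph k'.+2)
  else cycle_graph p.

(* Main.v *)
Require Import Defs.
From mathcomp Require Import all_boot.
From mathcomp Require Import all_order all_algebra all_field.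
From mathcomp Require Import finmap multiset zify ring.
From mathcomp Require perm.

Set Implicit Arguments.
Unset Strict Implicit.
Unset Printing Implicit Defensive.

Import GRing.Theory Num.Theory.

(** A graph H with the spectrum of L = L(p,k) has the characteristic polynomial
    of L, and the proof reads three things off that polynomial.

    Degrees.  The polynomial determines the number n of vertices and the traces
    of the second and fourth powers of the adjacency matrix A.  The first trace
    is the sum of the degrees.  The second is the sum over all ordered pairs
    (x, y) of the squared number of common neighbours; since a natural number
    is at most its square, it is bounded below in terms of the degrees, with
    equality when no two distinct vertices have two common neighbours, i.e.
    when there is no 4-cycle.  L has no 4-cycle, so the sum of the squared
    degrees of H is at most that of L ([sum_sqr_deg_le],
    [sum_sqr_deg_codeg1]).  Hence the sum of (d(x) - 2)^2 over H is at most its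
    value for L, namely 2, or 0 when k = 0, while the sum of d(x) - 2 is 0:
    either H is 2-regular, or k > 0 and H has one vertex of degree 1, one of
    degree 3 and all others of degree 2 ([cospectral_lollipop_degrees]).

    Shape.  A maximal path of H starting at the vertex of degree 1, or anywhere
    if H is 2-regular, must close up on itself at its far end, and the degrees
    leave room for nothing else.  It therefore spans a component L(q,j) of H,
    and the rest of H is 2-regular ([lollipop_component]).  If the rest is not
    empty, its all-ones vector makes 2 a root of its characteristic polynomial.

    Arithmetic.  Let U_m be the characteristic polynomial of the path with m
    vertices (a Chebyshev polynomial: U_0 = 1, U_1 = X and
    U_(m+2) = X U_(m+1) - U_m).  Then L(p,k) has characteristic polynomial
    P_(p,k) = U_(p+k) - U_(p-2) U_k - 2 U_k ([det_lollipop]), whose value at 2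
    is -pk; and P_(p,0) has derivative p^2 at 2, so that 2 is a simple root of
    it.  This forces the rest of H to be empty: otherwise
    P_(p,k) = P_(q,j) R with R(2) = 0, so k = 0, so H is 2-regular and j = 0,
    and 2 would be a double root.  So H is L(q,j) with q + j = p + k and
    P_(q,j) = P_(p,k).  Evaluating at 2, qj = pk, whence q = p or (q,j) = (k,p);
    and P_(p,k) = P_(k,p) only if p = k ([lollipop_poly_swap]). *)

Local Open Scope ring_scope.

(** * Determinants of paths, cycles and lollipops *)

Definition nat_mx (S : Type) n (g : nat -> nat -> S) : 'M[S]_n :=
  \matrix_(i < n, j < n) g i j.

(** The entries of x - A, where A is the adjacency matrix of a graph on an
    initial segment of [nat]; indexing by [nat] rather than by ordinals makes
    deleting a leaf a mere shift of the indices. *)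
Definition char_entry (S : pzRingType) (x : S) (e : rel nat) (i j : nat) : S :=
  x *+ (i == j) - (e i j)%:R.

Definition path_rel : rel nat := fun i j => (j == i.+1) || (i == j.+1).

(** Numbering of L(p,k) along one long path from the leaf: the tail is
    0, ..., k-1 and the cycle is k, ..., k+p-1, closed by the edge between its
    first and last vertices.  For k = 0 this is the cycle. *)
Definition lollipop_rel (p k : nat) : rel nat := fun i j =>
  path_rel i j || (i == k) && (j == (k + p).-1)
               || (j == k) && (i == (k + p).-1).

Lemma path_rel_sym : symmetric path_rel.
Proof. by move=> i j; rewrite /path_rel orbC. Qed.

Lemma lollipop_rel_sym p k : symmetric (lollipop_rel p k).
Proof. by move=> i j; rewrite /lollipop_rel path_rel_sym orbAC. Qed.

Lemma eq_nat_mx (S : Type) n (g g' : nat -> nat -> S) :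
  (forall i j, (i < n)%N -> (j < n)%N -> g i j = g' i j) ->
  nat_mx n g = nat_mx n g'.
Proof. by move=> eq_g; apply/matrixP=> i j; rewrite !mxE eq_g. Qed.

Lemma cofactor_nat_mx (S : comPzRingType) n (g : nat -> nat -> S) i0 j0 :
  cofactor (nat_mx n.+1 g) i0 j0 =
    (-1) ^+ (i0 + j0) * \det (nat_mx n (fun i j => g (bump i0 i) (bump j0 j))).
Proof. by congr (_ * \det _); apply/matrixP=> i j; rewrite !mxE. Qed.

(** Deleting a leaf: expansion along the row of 0, then along the column of 0
    in the minor that deletes its only neighbour 1. *)
Lemma det_leaf (S : comPzRingType) n (g : nat -> nat -> S) :
  (forall j, g 0%N j.+2 = 0) -> (forall i, g i.+2 0%N = 0) ->
  \det (nat_mx n.+2 g) =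
    g 0%N 0%N * \det (nat_mx n.+1 (fun i j => g i.+1 j.+1))
    - g 0%N 1%N * g 1%N 0%N * \det (nat_mx n (fun i j => g i.+2 j.+2)).
Proof.
move=> row0 col0; rewrite (expand_det_row _ ord0) !big_ord_recl big1; last first.
  by move=> i _; rewrite mxE row0 mul0r.
rewrite addr0 !mxE /= -!mulrA -mulrN !cofactor_nat_mx expr0 mul1r.
congr (_ + _ * _); rewrite expr1 mulN1r; congr (- _).
rewrite (expand_det_col _ ord0) !big_ord_recl big1 ?addr0; last first.
  by move=> i _; rewrite !mxE /= col0 mul0r.
by rewrite mxE cofactor_nat_mx expr0 mul1r.
Qed.

Lemma det_nat_mx_lower (S : comPzRingType) n (g : nat -> nat -> S) :
  (forall i j, (i < j < n)%N -> g i j = 0) ->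
  \det (nat_mx n g) = \prod_(i < n) g i i.
Proof.
move=> low; rewrite det_trig; last first.
  by apply/is_trig_mxP=> i j ij; rewrite mxE low // ij ltn_ord.
by apply: eq_bigr=> i _; rewrite mxE.
Qed.

Lemma det_nat_mx_tr (S : comPzRingType) n (g : nat -> nat -> S) :
  \det (nat_mx n g) = \det (nat_mx n (fun i j => g j i)).
Proof. by rewrite -det_tr; congr (\det _); apply/matrixP=> i j; rewrite !mxE. Qed.

(** Carrying two consecutive values makes the two-step recurrence structural. *)
Fixpoint path_poly_pair (S : pzRingType) (x : S) n : S * S :=
  if n is m.+1 then
    let: (a, b) := path_poly_pair x m in (b, x * b - a)
  else (1, x).

Definition path_poly (S : pzRingType) (x : S) n : S := (path_poly_pair x n).1.

Lemma path_poly0 (S : pzRingType) (x : S) : path_poly x 0 = 1.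
Proof. by []. Qed.

Lemma path_poly1 (S : pzRingType) (x : S) : path_poly x 1 = x.
Proof. by []. Qed.

Lemma path_polySS (S : pzRingType) (x : S) n :
  path_poly x n.+2 = x * path_poly x n.+1 - path_poly x n.
Proof. by rewrite /path_poly /=; case: (path_poly_pair x n). Qed.

Lemma nat_ind2 (P : nat -> Prop) :
  P 0%N -> P 1%N -> (forall n, P n -> P n.+1 -> P n.+2) -> forall n, P n.
Proof.
move=> P0 P1 PSS n; suff [//] : P n /\ P n.+1.
by elim: n => [//|n [Pn PSn]]; split=> //; apply: PSS.
Qed.

Lemma det_path (S : comPzRingType) (x : S) n :
  \det (nat_mx n (char_entry x path_rel)) = path_poly x n.
Proof.
elim/nat_ind2: n => [||n IHn IHSn].
- by rewrite det_mx00.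
- by rewrite det_mx11 mxE /char_entry /path_rel /= subr0.
rewrite det_leaf; [|by move=> j; rewrite /char_entry /path_rel /= subr0..].
rewrite path_polySS -IHn -IHSn /char_entry /path_rel /=.
by rewrite subr0 mulr1n !mulr0n !sub0r mulrNN mulr1 mul1r.
Qed.

(** In the minors of the matrix of a cycle obtained by deleting the row of a
    vertex and the column of one of its neighbours, the first column is zero
    except at its two ends. *)
Lemma det_col_ends (S : comPzRingType) n (h : nat -> nat -> S) :
  (forall i, (0 < i < n.+1)%N -> h i 0%N = 0) ->
  \det (nat_mx n.+2 h) =
    h 0%N 0%N * \det (nat_mx n.+1 (fun i j => h i.+1 j.+1))
    + (-1) ^+ n.+1 * h n.+1 0%N * \det (nat_mx n.+1 (fun i j => h i j.+1)).
Proof.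
move=> h0; rewrite (expand_det_col _ ord0) big_ord_recl big_ord_recr /= big1 ?add0r.
  rewrite !mxE !cofactor_nat_mx expr0 mul1r; congr (_ + _).
  rewrite [in RHS](mulrC ((-1) ^+ _)) -mulrA addn0; congr (_ * (_ * \det _)).
  apply: eq_nat_mx=> i j im _; congr (h _ _).
  by rewrite /= /bump leq0n add1n leqNgt im.
by move=> i _; rewrite mxE h0 ?mul0r //= /bump leq0n; have := ltn_ord i; lia.
Qed.

(** Expansion along the row of 0, whose neighbours are 1 and m+2.  Each of the
    two off-diagonal minors splits by [det_col_ends] into that of a path with m+1
    vertices and a triangular one with diagonal -1; the two triangular
    determinants are the two orientations of the cycle and give the final -2. *)
Lemma det_cycle (S : comPzRingType) (x : S) m :
  \det (nat_mx m.+3 (char_entry x (lollipop_rel m.+3 0))) =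
  path_poly x m.+3 - path_poly x m.+1 - 2%:R.
Proof.
set e := lollipop_rel m.+3 0; set g := char_entry x e.
have g00 : g 0%N 0%N = x by rewrite /g /char_entry /e /lollipop_rel /path_rel /= subr0.
have g01 : g 0%N 1%N = -1 by rewrite /g /char_entry /e /lollipop_rel /path_rel /= sub0r.
have gC i j : g i j = g j i.
  by rewrite /g /char_entry eq_sym /e lollipop_rel_sym.
have g0m : g 0%N m.+2 = -1.
  have e0m : e 0%N m.+2 by rewrite /e /lollipop_rel (eqxx m.+2) orbT.
  by rewrite /g /char_entry e0m sub0r.
have g0z i : (i < m)%N -> g 0%N i.+2 = 0.
  move=> im; rewrite /g /char_entry /e /lollipop_rel /path_rel /=.
  by rewrite (_ : _ || _ = false) ?subr0 //; lia.
have gpath i j : (0 < i)%N -> (0 < j)%N -> g i j = char_entry x path_rel i j.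
  move=> i0 j0; rewrite /g /char_entry /e /lollipop_rel; congr (_ - (nat_of_bool _)%:R).
  by lia.
have sub1 n a : (0 < a)%N ->
    \det (nat_mx n (fun i j => g (a + i)%N (a + j)%N)) = path_poly x n.
  move=> a0; rewrite -det_path; congr (\det _); apply: eq_nat_mx=> i j _ _.
  rewrite gpath ?addn_gt0 ?a0 // /char_entry /path_rel -!addnS !eqn_add2l.
  by [].
have tri n a b : (0 < a)%N -> (0 < b)%N -> b = a.+1 ->
    \det (nat_mx n (fun i j => g (a + i)%N (b + j)%N)) = (-1) ^+ n.
  move=> a0 b0 ->; rewrite det_nat_mx_lower; last first.
    move=> i j ij; rewrite gpath ?addn_gt0 ?a0 // /char_entry.
    have /negPf-> : (a + i != a.+1 + j)%N by lia.
    have /negPf-> : ~~ path_rel (a + i)%N (a.+1 + j)%N by rewrite /path_rel; lia.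
    by rewrite subr0.
  rewrite -[in RHS](card_ord n) -prodr_const; apply: eq_bigr=> i _.
  rewrite gpath ?addn_gt0 ?a0 // /char_entry.
  have /negPf-> : (a + i != a.+1 + i)%N by lia.
  have -> : path_rel (a + i)%N (a.+1 + i)%N by rewrite /path_rel; lia.
  by rewrite sub0r.
rewrite (expand_det_row _ ord0) big_ord_recl big_ord_recl big_ord_recr /=.
rewrite big1 ?add0r; last first.
  by move=> i _; rewrite mxE /= g0z ?mul0r.
rewrite !mxE /= g00 g01 g0m.
have -> : cofactor (nat_mx m.+3 g) ord0 ord0 = path_poly x m.+2.
  by rewrite cofactor_nat_mx expr0 mul1r (sub1 m.+2 1%N).
have -> : cofactor (nat_mx m.+3 g) ord0 (lift ord0 ord0) = path_poly x m.+1 + 1.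
  rewrite cofactor_nat_mx expr1 mulN1r det_col_ends /=; last first.
    by move=> [|i] //= im; rewrite gC g0z.
  rewrite gC g01 gC g0m (sub1 m.+1 2%N) // (tri m.+1 1%N 2%N) //.
  by rewrite mulrAC -expr2 sqrr_sign; ring.
have -> : cofactor (nat_mx m.+3 g) ord0 (lift ord0 (lift ord0 ord_max)) = path_poly x m.+1 + 1.
  rewrite cofactor_nat_mx /=.
  rewrite (@eq_nat_mx _ _ _ (fun i j => g i.+1 j)); last first.
    move=> i j _ jm; congr (g _ _).
    by rewrite /bump leq0n !add1n leqNgt jm.
  rewrite det_col_ends /=; last first.
    by move=> [|i] //= im; rewrite gC g0z.
  rewrite gC g01 gC g0m (sub1 m.+1 1%N) //.
  rewrite det_nat_mx_tr (@eq_nat_mx _ _ _ (fun i j => g i.+1 j.+2)); last first.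
    by move=> i j _ _; apply: gC.
  rewrite (tri m.+1 1%N 2%N) //.
  rewrite /bump /= add0n !add1n !exprS.
  set s := (-1) ^+ _; have : s * s = 1 by rewrite /s -expr2 sqrr_sign.
  move=> ss; transitivity (s * s * (path_poly x m.+1 + 1)); first by ring.
  by rewrite ss mul1r.
by rewrite (path_polySS x m.+1); ring.
Qed.

(** By [det_leaf], both sides satisfy the recurrence of the path polynomials in
    k, so only k = 0 (the cycle) and k = 1 need checking. *)
Lemma det_lollipop (S : comPzRingType) (x : S) m k :
  \det (nat_mx (k + m.+3) (char_entry x (lollipop_rel m.+3 k))) =
  path_poly x (k + m.+3) - path_poly x m.+1 * path_poly x k - 2%:R * path_poly x k.
Proof.
have shift k' i j : lollipop_rel m.+3 k'.+1 i.+1 j.+1 = lollipop_rel m.+3 k' i j.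
  by rewrite /lollipop_rel /path_rel !addSn !addnS /= !eqSS.
have leaf k' : \det (nat_mx (k'.+1 + m.+3) (char_entry x (lollipop_rel m.+3 k'.+1))) =
   x * \det (nat_mx (k' + m.+3) (char_entry x (lollipop_rel m.+3 k')))
   - \det (nat_mx (k' + m.+2) (fun i j => char_entry x (lollipop_rel m.+3 k'.+1) i.+2 j.+2)).
  have e0 j : lollipop_rel m.+3 k'.+1 0 j.+2 = false.
    by rewrite /lollipop_rel /path_rel /= addnS andbF.
  have e1 : lollipop_rel m.+3 k'.+1 0 1 by [].
  rewrite addSn addnS det_leaf; first last.
  - by move=> i; rewrite /char_entry lollipop_rel_sym e0 subr0.
  - by move=> j; rewrite /char_entry e0 subr0.
  rewrite {1 3 4}/char_entry (lollipop_rel_sym _ _ 1) e1 sub0r mulrNN mulr1 mul1r.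
  rewrite {1}/lollipop_rel /path_rel /= subr0 -!addnS; congr (x * \det _ - _).
  by apply: eq_nat_mx=> i j _ _; rewrite /char_entry shift.
elim/nat_ind2: k => [||k IHk IHSk].
- by rewrite det_cycle !mulr1.
- rewrite leaf det_cycle (@eq_nat_mx _ _ _ (char_entry x path_rel)); last first.
    move=> i j im jm; rewrite /char_entry; congr (_ - (nat_of_bool _)%:R).
    by rewrite shift /lollipop_rel /path_rel; lia.
  by rewrite det_path add0n add1n (path_polySS x m.+2) path_poly1; ring.
rewrite leaf IHSk (@eq_nat_mx _ _ _ (char_entry x (lollipop_rel m.+3 k))); last first.
  by move=> i j im jm; rewrite /char_entry !shift.
rewrite (addSnnS k m.+2) IHk !addSn !path_polySS; ring.
Qed.

(** * Characteristic polynomials of paths and lollipops *)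

Definition lollipop_poly (R : nzRingType) (p k : nat) : {poly R} :=
  path_poly 'X (k + p) - path_poly 'X p.-2 * path_poly 'X k - 2%:R * path_poly 'X k.

Local Notation U := (path_poly 'X).

Lemma path_poly_horner2 (R : comNzRingType) n : (U n : {poly R}).[2%:R] = n.+1%:R.
Proof.
elim/nat_ind2: n => [||n IHn IHSn]; first by rewrite hornerC.
  by rewrite hornerX.
by rewrite path_polySS hornerD hornerN hornerM hornerX IHn IHSn -!natr1; ring.
Qed.

(** The factor 6 keeps the value n(n+1)(n+2)/6 free of division. *)
Lemma path_poly_deriv2 (R : comNzRingType) n :
  6%:R * (U n : {poly R})^`().[2%:R] = (n * n.+1 * n.+2)%:R.
Proof.
elim/nat_ind2: n => [||n IHn IHSn]; first by rewrite derivC hornerC mulr0.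
  by rewrite derivX hornerC mulr1.
rewrite path_polySS derivB derivM derivX !hornerE path_poly_horner2 mulrBr IHn.
rewrite mulrDr mulrCA IHSn !natrM -!natr1; ring.
Qed.

Lemma lollipop_poly_horner2 (R : comNzRingType) p k : (1 < p)%N ->
  (lollipop_poly R p k).[2%:R] = - (p * k)%:R.
Proof.
case: p => [|[|m]] // _.
rewrite /lollipop_poly !hornerE !path_poly_horner2 /= natrM -!natr1 natrD -!natr1; ring.
Qed.

(** As the derivative is not zero in characteristic 0, the root 2 of the
    characteristic polynomial of a cycle is simple. *)
Lemma cycle_poly_deriv2 (R : comNzRingType) p : (1 < p)%N ->
  6%:R * (lollipop_poly R p 0)^`().[2%:R] = (6 * p ^ 2)%:R.
Proof.
case: p => [|[|m]] // _.
rewrite /lollipop_poly path_poly0 !mulr1 add0n !derivB !hornerE !mulrBr.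
rewrite !path_poly_deriv2 -polyC_natr derivC hornerC mulr0 subr0.
rewrite !natrM -!natr1; ring.
Qed.

Lemma size_path_poly (R : idomainType) n : size (U n : {poly R}) = n.+1.
Proof.
elim/nat_ind2: n => [||n IHn IHSn]; first by rewrite size_polyC oner_neq0.
  by rewrite size_polyX.
have szX : size ('X * U n.+1 : {poly R}) = n.+3.
  by rewrite mulrC size_mulX ?IHSn // -size_poly_eq0 IHSn.
by rewrite path_polySS size_polyDl szX // size_polyN IHn.
Qed.

(** The Casoratian of two shifts of a solution of
    u_(n+2) = X u_(n+1) - u_n is constant, so the left-hand side does not depend
    on a; the point is that the products of degree 2a+d+2 cancel. *)
Lemma path_poly_cross (R : comNzRingType) a d :
  U (a + d) * U a.+2 - U (a + d).+2 * U a = 'X * (U d * 'X - U d.+1) :> {poly R}.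
Proof.
have cassini : U (a + d) * U a.+1 - U (a + d).+1 * U a = U d * 'X - U d.+1 :> {poly R}.
  elim: a => [|a IHa]; first by rewrite mulr1.
  by rewrite -IHa !addSn !path_polySS; ring.
by rewrite -cassini !path_polySS; ring.
Qed.

(** Say p < k.  Equality gives 2 (U_k - U_p) = U_(k-2) U_p - U_k U_(p-2).  The
    left-hand side has degree k, and by [path_poly_cross] the degree of the
    right-hand side is at most k - p + 2. *)
Lemma lollipop_poly_swap (R : numDomainType) p k : (2 < p)%N -> (2 < k)%N ->
  lollipop_poly R p k = lollipop_poly R k p -> p = k.
Proof.
wlog lt_pk : p k / (p < k)%N => [hwlog p3 k3 eqP|].
  by case: (ltngtP p k) => // [/hwlog|/hwlog hkp]; [exact | exact/esym/hkp].
case: p k lt_pk => [|[|m]] [|[|k]] // lt_mk m0 _.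
have [d ->] : exists d, k = (m + d.+1)%N by exists (k - m).-1; lia.
rewrite /lollipop_poly (addnC _ m.+2) /= => /esym eqP.
have {eqP} : 2%:R * ((U (m + d.+1).+2 : {poly R}) - U m.+2) = 'X * (U d.+1 * 'X - U d.+2).
  rewrite -(path_poly_cross _ m); apply: subr0_eq.
  move: eqP => /eqP; rewrite -subr_eq0 => /eqP <-; ring.
move/(congr1 (fun q : {poly R} => q`_(m + d.+1).+2)).
rewrite -polyC_natr coefCM coefB coefXM /= [(U m.+2 : {poly R})`_ _]nth_default; last first.
  by rewrite size_path_poly; lia.
rewrite [RHS]nth_default; last first.
  rewrite (leq_trans (size_polyD _ _)) // geq_max size_polyN size_path_poly.
  by rewrite size_mulX -?size_poly_eq0 size_path_poly //; lia.
move/eqP; rewrite subr0 mulf_eq0 pnatr_eq0 /=.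
have -> : (U (m + d.+1).+2 : {poly R})`_(m + d.+1).+2 = lead_coef (U (m + d.+1).+2).
  by rewrite lead_coefE size_path_poly.
by rewrite lead_coef_eq0 -size_poly_eq0 size_path_poly.
Qed.

(** The values at 2 give p k = q j; with p + k = q + j, either p = q or the two
    parameters are exchanged. *)
Lemma lollipop_poly_inj (R : numDomainType) p k q j :
  (2 < p)%N -> (2 < q)%N -> (k + p = j + q)%N ->
  lollipop_poly R p k = lollipop_poly R q j -> p = q.
Proof.
move=> p3 q3 eq_n eqPoly.
have /eqP : (lollipop_poly R p k).[2%:R] = (lollipop_poly R q j).[2%:R] by rewrite eqPoly.
rewrite !lollipop_poly_horner2 ?(ltnW p3) ?(ltnW q3) // eqr_opp eqr_nat => /eqP eq_pk.
have [//|[eq_kq eq_jp]] : p = q \/ k = q /\ j = p.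
  have := ltnW p3; have := ltnW q3; nia.
by subst k j; apply: lollipop_poly_swap eqPoly.
Qed.

(** * What the characteristic polynomial of a graph determines *)

Definition graph_poly (G : sgraph) : {poly algC} := char_poly (adjacency_mx G).

Lemma cospectral_graph_poly G H : cospectral G H -> graph_poly G = graph_poly H.
Proof.
rewrite /cospectral /spectrum -!/(graph_poly _).
case: closed_field_poly_normal => rG /= eqG; case: closed_field_poly_normal => rH /= eqH.
move/eq_seq_msetP => eq_r; rewrite eqG eqH.
rewrite !(monicP (char_poly_monic _)) !scale1r.
exact: perm_big.
Qed.

Lemma graph_poly_card G H : graph_poly G = graph_poly H -> #|G| = #|H|.
Proof. by move/(congr1 (fun p : {poly _} => size p)); rewrite !size_char_poly => -[]. Qed.

(** The vertices may be numbered in any order: two numberings differ by a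
    permutation acting on both rows and columns. *)
Lemma graph_poly_reindex (G : sgraph) n (h : 'I_n -> G) : injective h -> n = #|G| ->
  graph_poly G = char_poly (\matrix_(i, j) (adj (h i) (h j))%:R : 'M[algC]_n).
Proof.
move=> inj_h eq_n; subst n.
pose s := perm.perm (inj_comp enum_rank_inj inj_h).
set B := \matrix_(i, j) _.
have -> : char_poly B = \det (row_perm s (col_perm s (char_poly_mx (adjacency_mx G)))).
  congr (\det _); apply/matrixP=> i j; rewrite !mxE !perm.permE /= !enum_rankK.
  by rewrite (inj_eq enum_rank_inj) (inj_eq inj_h).
rewrite row_permE col_permE !det_mulmx !det_perm perm.odd_permV mulrCA.
by rewrite -signr_addb addbb mulr1.
Qed.

(** X^2 - A^2 = (X - A) (X + A), and det (X + A) is up to sign the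
    characteristic polynomial of A evaluated at -X. *)
Lemma char_poly_sqr (R : comNzRingType) n (A : 'M[R]_n) :
  char_poly (A *m A) \Po 'X^2 = (-1) ^+ n * char_poly A * (char_poly A \Po - 'X).
Proof.
have comp_char (B : 'M[R]_n) (q : {poly R}) :
    char_poly B \Po q = \det (q%:M - map_mx polyC B).
  rewrite /char_poly -[_ \Po q]/(comp_poly q _) -det_map_mx; congr (\det _).
  apply/matrixP=> i j; rewrite !mxE raddfB /= raddfMn /= comp_polyX comp_polyC //.
rewrite !comp_char /char_poly -mulrA mulrCA -detZ -det_mulmx; congr (\det _).
rewrite /char_poly_mx scaleN1r opprB raddfN /= opprK map_mxM /=.
rewrite mulmxBl !mulmxDr -scalar_mxM -expr2 (scalar_mxC 'X) opprD.
by rewrite [RHS]addrC addrA subrK addrC.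
Qed.

(** Applied repeatedly, this shows that the characteristic polynomial determines
    the traces of A^2 and A^4, without any diagonalisation. *)
Lemma char_poly_sqr_inj (R : comNzRingType) n m (A : 'M[R]_n) (B : 'M[R]_m) :
  char_poly A = char_poly B -> char_poly (A *m A) = char_poly (B *m B).
Proof.
move=> eqAB; have eq_nm : n = m.
  by move/(congr1 (fun p : {poly _} => size p)): eqAB; rewrite !size_char_poly => -[].
have eq_comp : char_poly (A *m A) \Po 'X^2 = char_poly (B *m B) \Po 'X^2.
  by rewrite !char_poly_sqr eqAB eq_nm.
apply/polyP=> i; have /(congr1 (fun p : {poly _} => p`_(i * 2))) := eq_comp.
by rewrite !coef_comp_poly_Xn // dvdn_mull // mulnK.
Qed.

Lemma char_poly_eq_trace (R : nzRingType) n m (A : 'M[R]_n) (B : 'M[R]_m) :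
  char_poly A = char_poly B -> \tr A = \tr B.
Proof.
move=> eqAB; have eq_nm : n = m.
  by move/(congr1 (fun p : {poly _} => size p)): eqAB; rewrite !size_char_poly => -[].
subst m; case: n => [|n] in A B eqAB *; first by rewrite /mxtrace !big_ord0.
by apply: oppr_inj; rewrite -!char_poly_trace // eqAB.
Qed.

Lemma graph_poly_nat_mx (G : sgraph) n (h : 'I_n -> G) (e : rel nat) :
  injective h -> n = #|G| -> (forall i j, adj (h i) (h j) = e i j) ->
  graph_poly G = \det (nat_mx n (char_entry 'X e)).
Proof.
move=> inj_h eq_n adjE; rewrite (graph_poly_reindex inj_h eq_n); congr (\det _).
by apply/matrixP=> i j; rewrite !mxE adjE /char_entry polyC_natr.
Qed.

(** * Degrees of a graph cospectral with a lollipop *)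

Definition deg (G : sgraph) (x : G) : nat := #|[set y | adj x y]|.

Definition codeg (G : sgraph) (x y : G) : nat := #|[set z | adj x z && adj y z]|.

Lemma sum_over_enum_val (T : finType) (V : nmodType) (F : T -> V) :
  \sum_(i < #|T|) F (enum_val i) = \sum_x F x.
Proof. by rewrite -big_enum_val. Qed.

Lemma degE (G : sgraph) (x : G) : deg x = (\sum_y adj x y)%N.
Proof. by rewrite /deg -sum1dep_card big_mkcond; apply: eq_bigr=> y _; case: adj. Qed.

Lemma codegE (G : sgraph) (x y : G) : codeg x y = (\sum_z adj x z * adj y z)%N.
Proof.
rewrite /codeg -sum1dep_card big_mkcond; apply: eq_bigr=> z _.
by rewrite mulnb; case: (_ && _).
Qed.

Lemma codegxx (G : sgraph) (x : G) : codeg x x = deg x.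
Proof. by apply: eq_card=> y; rewrite !inE andbb. Qed.

Lemma codegC (G : sgraph) (x y : G) : codeg x y = codeg y x.
Proof. by apply: eq_card=> z; rewrite !inE andbC. Qed.

Lemma adjacency_sqr (G : sgraph) i j :
  (adjacency_mx G *m adjacency_mx G) i j = (codeg (enum_val i) (enum_val j))%:R.
Proof.
rewrite mxE codegE natr_sum -[RHS]sum_over_enum_val; apply: eq_bigr=> k _.
by rewrite !mxE natrM [adj (enum_val k) _]adj_sym.
Qed.

Lemma sum_deg_spectral (G H : sgraph) : graph_poly G = graph_poly H ->
  (\sum_(x : G) deg x = \sum_(x : H) deg x)%N.
Proof.
move/char_poly_sqr_inj/char_poly_eq_trace => eq_tr; apply/eqP; rewrite -(eqr_nat algC).
suff trE (K : sgraph) : \tr (adjacency_mx K *m adjacency_mx K) = (\sum_(x : K) deg x)%:R.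
  by rewrite -!trE eq_tr.
rewrite natr_sum -sum_over_enum_val; apply: eq_bigr=> i _.
by rewrite adjacency_sqr codegxx.
Qed.

Lemma sum_codeg_spectral (G H : sgraph) : graph_poly G = graph_poly H ->
  (\sum_(x : G) \sum_(y : G) codeg x y ^ 2 = \sum_(x : H) \sum_(y : H) codeg x y ^ 2)%N.
Proof.
move/char_poly_sqr_inj/char_poly_sqr_inj/char_poly_eq_trace => eq_tr.
apply/eqP; rewrite -(eqr_nat algC).
suff trE (K : sgraph) : let A := adjacency_mx K in
    \tr (A *m A *m (A *m A)) = (\sum_(x : K) \sum_(y : K) codeg x y ^ 2)%:R.
  by rewrite -!trE eq_tr.
rewrite /= natr_sum -sum_over_enum_val; apply: eq_bigr=> i _.
rewrite mxE /= natr_sum -[RHS]sum_over_enum_val; apply: eq_bigr=> j _.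
by rewrite !adjacency_sqr [codeg (enum_val j) _]codegC natrM.
Qed.

(** Both sides count the walks of length 2, on the right by their middle
    vertex. *)
Lemma sum_codeg (G : sgraph) :
  (\sum_(x : G) \sum_(y : G) codeg x y = \sum_(x : G) deg x ^ 2)%N.
Proof.
under eq_bigr do (under eq_bigr do rewrite codegE; rewrite exchange_big /=).
rewrite exchange_big /=; apply: eq_bigr=> z _.
under eq_bigr do rewrite -big_distrr /=.
rewrite -big_distrl /= expnS expn1 degE.
by congr (_ * _)%N; apply: eq_bigr=> y _; rewrite adj_sym.
Qed.

(** Off the diagonal, [codeg x y <= codeg x y ^ 2]; the sum of the left-hand
    sides over x != y is the sum of d(x)^2 - d(x) by [sum_codeg], and the
    diagonal terms are the d(x)^2. *)
Lemma sum_sqr_deg_le (G : sgraph) :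
  (2 * \sum_(x : G) deg x ^ 2
     <= \sum_(x : G) \sum_(y : G) codeg x y ^ 2 + \sum_(x : G) deg x)%N.
Proof.
rewrite mul2n -addnn -{2}sum_codeg -!big_split /=; apply: leq_sum=> x _.
rewrite (bigD1 x) //= [X in (_ <= X + _)%N](bigD1 x) //= codegxx.
rewrite addnA addnAC leq_add2r leq_add2l; apply: leq_sum=> y _.
by case: codeg => // n; rewrite expnS expn1 leq_pmulr.
Qed.

Lemma sum_sqr_deg_codeg1 (G : sgraph) :
  (forall x y : G, x != y -> (codeg x y <= 1)%N) ->
  (2 * \sum_(x : G) deg x ^ 2
     = \sum_(x : G) \sum_(y : G) codeg x y ^ 2 + \sum_(x : G) deg x)%N.
Proof.
move=> codeg1.
rewrite mul2n -addnn -{2}sum_codeg -!big_split /=; apply: eq_bigr=> x _.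
rewrite (bigD1 x) //= [in RHS](bigD1 x) //= codegxx addnA addnAC; congr (_ + _ + _)%N.
by apply: eq_bigr=> y yx; have := codeg1 x y; rewrite eq_sym yx;
  case: codeg => [|[|n]] // /(_ isT).
Qed.

(** The deviations d(x) - 2 have sum 0 and sum of squares at most 2 b.  If they
    are not all zero, one is negative and one is positive, and these two already
    use up the bound. *)
Lemma degrees_close_to_two (H : sgraph) (b : bool) :
  (\sum_(x : H) deg x = 2 * #|H|)%N ->
  (\sum_(x : H) deg x ^ 2 <= 4 * #|H| + 2 * b)%N ->
  (forall x : H, deg x = 2%N)
  \/ b /\ exists u w : H, [/\ deg u = 1%N, deg w = 3%N &
         forall z, z != u -> z != w -> deg z = 2%N].
Proof.
move=> sum1 sum2.
pose e (x : H) : int := (deg x)%:Z - 2.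
have sumZ (F : H -> nat) : \sum_x (F x)%:Z = (\sum_x F x)%N%:Z.
  by rewrite (big_morph Posz PoszD (erefl _)).
have constZ (c : int) : \sum_(x : H) c = c * #|H|%:Z.
  by rewrite sumr_const -(mulr_natr c) natz.
have sum_e : \sum_x e x = 0.
  rewrite big_split /= sumZ sum1 constZ; lia.
have sum_e2 : \sum_x e x ^+ 2 <= 2 * b%:Z.
  have e2E x : e x ^+ 2 = (deg x ^ 2)%N%:Z + (-4 * (deg x)%:Z + 4).
    by rewrite /e; lia.
  rewrite (eq_bigr _ (fun x _ => e2E x)) !big_split /= -mulr_sumr constZ !sumZ sum1.
  by lia.
have e2_ge0 x : 0 <= e x ^+ 2 by rewrite sqr_ge0.
case: (pickP (fun x : H => e x != 0)) => [x0 ex0|e0]; last first.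
  by left=> x; have /eqP := e0 x; rewrite /e; lia.
right.
have [u eu] : exists u, e u < 0.
  case: (pickP (fun u : H => e u < 0)) => [u|e_ge0]; first by exists u.
  have /psumr_eq0P-/(_ sum_e) e0 : forall x, true -> 0 <= e x.
    by move=> x _; have := e_ge0 x; lia.
  by have := e0 x0 isT; lia.
have [w ew] : exists w, e w > 0.
  case: (pickP (fun w : H => e w > 0)) => [w|e_le0]; first by exists w.
  have /psumr_eq0P : forall x, true -> 0 <= - e x.
    by move=> x _; have := e_le0 x; lia.
  by rewrite sumrN sum_e oppr0 => /(_ erefl x0 isT); lia.
have ne_uw : w != u by apply: contraTneq ew => ->; lia.
have e2_gt0 x : e x != 0 -> 1 <= e x ^+ 2 by rewrite -sqrf_eq0; have := e2_ge0 x; lia.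
have e2u : 1 <= e u ^+ 2 by apply: e2_gt0; lia.
have e2w : 1 <= e w ^+ 2 by apply: e2_gt0; lia.
move: sum_e2; rewrite (bigD1 u) //= (bigD1 w) //=.
set rest := (X in _ + (_ + X)).
have rest_ge0 : 0 <= rest by apply: sumr_ge0.
case: b sum2 => sum2 sum_e2; last by exfalso; lia.
split=> //; exists u, w; split.
- by have : e u ^+ 2 = 1; [lia | rewrite /e in eu *; nia].
- by have : e w ^+ 2 = 1; [lia | rewrite /e in ew *; nia].
move=> z zu zw; apply/eqP; apply/negPn/negP => dz.
have e2z : 1 <= e z ^+ 2 by apply: e2_gt0; rewrite /e; lia.
move: sum_e2; rewrite /rest (bigD1 z) ?zu //=.
set rest' := (X in _ + (_ + (_ + X))).
have rest'_ge0 : 0 <= rest' by apply: sumr_ge0.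
by lia.
Qed.

Local Close Scope ring_scope.

Definition is_lollipop p k (G : sgraph) :=
  exists2 h : 'I_(k + p) -> G, bijective h &
    forall i j, adj (h i) (h j) = lollipop_rel p k i j.

Lemma sum_eq_ord n c : \sum_(j < n) (j == c :> nat) = (c < n).
Proof.
case: (ltnP c n) => [c_lt_n|n_le_c].
  rewrite (bigD1 (Ordinal c_lt_n)) //= eqxx big1 // => j.
  by rewrite -val_eqE /= => /negPf->.
by rewrite big1 // => j _; case: eqP => // eq_j; have := ltn_ord j; lia.
Qed.

(** The term for i = 0 is on the left to avoid a truncated subtraction; when
    k = 0 the two corrections cancel. *)
Lemma lollipop_rel_deg p k i : 2 < p -> i < k + p ->
  \sum_(j < k + p) lollipop_rel p k i j + (i == 0) = 2 + (i == k).
Proof.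
move=> p3 i_lt.
have relE (j : 'I_(k + p)) : lollipop_rel p k i j =
    (j == i.+1 :> nat) + ((0 < i) && (j == i.-1 :> nat))
    + ((i == k) && (j == (k + p).-1 :> nat)) + ((i == (k + p).-1) && (j == k :> nat)) :> nat.
  have -> : (0 < i) && (j == i.-1 :> nat) = (i == j.+1) by lia.
  rewrite /lollipop_rel /path_rel; have := ltn_ord j.
  by do ?[case: eqP => ? /=]; lia.
under eq_bigr => j _ do rewrite relE -!mulnb.
rewrite !big_split /= -!big_distrr /= !sum_eq_ord; lia.
Qed.

(** Two distinct vertices with two common neighbours lie on a 4-cycle, and the
    only cycle of L(p,k) has p vertices. *)
Lemma lollipop_rel_codeg p k i j a b : 4 < p ->
  i < k + p -> j < k + p -> a < k + p -> b < k + p -> i != j ->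
  lollipop_rel p k i a -> lollipop_rel p k j a ->
  lollipop_rel p k i b -> lollipop_rel p k j b -> a = b.
Proof.
rewrite /lollipop_rel /path_rel; lia.
Qed.

Lemma lollipop_card p k G : is_lollipop p k G -> #|G| = k + p.
Proof. by case=> h bij_h _; rewrite -(bij_eq_card bij_h) card_ord. Qed.

Lemma lollipop_deg p k (G : sgraph) (h : 'I_(k + p) -> G) (i : 'I_(k + p)) :
  bijective h -> (forall i j, adj (h i) (h j) = lollipop_rel p k i j) -> 2 < p ->
  deg (h i) + (i == 0 :> nat) = 2 + (i == k :> nat).
Proof.
move=> bij_h adjE p3; rewrite -(lollipop_rel_deg p3 (ltn_ord i)) degE.
rewrite (reindex h) /=; last exact: onW_bij.
by congr (_ + _); apply: eq_bigr=> j _; rewrite adjE.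
Qed.

Lemma lollipop_sum_deg p k G : is_lollipop p k G -> 2 < p ->
  \sum_(x : G) deg x = 2 * #|G|.
Proof.
move=> LG p3; rewrite (lollipop_card LG); case: LG => h bij_h adjE.
rewrite (reindex h) /=; last exact: onW_bij.
suff : \sum_(i < k + p) (deg (h i) + (i == 0 :> nat)) = \sum_(i < k + p) (2 + (i == k :> nat)).
  by rewrite !big_split /= !sum_eq_ord sum_nat_const card_ord; lia.
by apply: eq_bigr=> i _; apply: lollipop_deg.
Qed.

Lemma lollipop_sum_sqr_deg p k G : is_lollipop p k G -> 2 < p ->
  \sum_(x : G) deg x ^ 2 = 4 * #|G| + 2 * (0 < k).
Proof.
move=> LG p3; rewrite (lollipop_card LG); case: LG => h bij_h adjE.
rewrite (reindex h) /=; last exact: onW_bij.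
(* The coefficients are made opaque so that [big_split] stops at them. *)
have [c cE] : exists c, c = 3 + 2 * (k == 0) by exists (3 + 2 * (k == 0)).
have [d dE] : exists d, d = 5 by exists 5.
suff : \sum_(i < k + p) (deg (h i) ^ 2 + c * (i == 0 :> nat)) =
       \sum_(i < k + p) (4 + d * (i == k :> nat)).
  rewrite !big_split -!big_distrr /= !sum_eq_ord sum_nat_const card_ord.
  have -> : 0 < k + p by lia.
  have -> : k < k + p by lia.
  by lia.
apply: eq_bigr=> i _; have := lollipop_deg i bij_h adjE p3.
by rewrite cE dE; do ?[case: eqP => ? /=]; move: (deg _) => e; nia.
Qed.

Lemma lollipop_codeg p k G : is_lollipop p k G -> 4 < p ->
  forall x y : G, x != y -> codeg x y <= 1.
Proof.
case=> h [g hK gK] adjE p5 x y; rewrite -(gK x) -(gK y) (can_eq hK) => ne_xy.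
apply/card_le1_eqP=> a b; rewrite !inE -(gK a) -(gK b) !adjE.
move=> /andP[xa ya] /andP[xb yb]; congr h; apply: val_inj.
by apply: lollipop_rel_codeg xb yb xa ya; rewrite ?ltn_ord.
Qed.

Lemma cospectral_lollipop_degrees p k (G H : sgraph) : is_lollipop p k G -> 4 < p ->
  graph_poly H = graph_poly G ->
  (forall x : H, deg x = 2)
  \/ 0 < k /\ exists u w : H, [/\ deg u = 1, deg w = 3 &
         forall z, z != u -> z != w -> deg z = 2].
Proof.
move=> LG p5 eqHG; have p3 : 2 < p by lia.
have eq_card := graph_poly_card eqHG.
have sum_deg := sum_deg_spectral eqHG.
apply: degrees_close_to_two; first by rewrite sum_deg (lollipop_sum_deg LG p3) eq_card.
rewrite -(leq_pmul2l (isT : 0 < 2)) (leq_trans (sum_sqr_deg_le _)) //.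
rewrite (sum_codeg_spectral eqHG) sum_deg -(sum_sqr_deg_codeg1 (lollipop_codeg LG p5)).
by rewrite (lollipop_sum_sqr_deg LG p3) eq_card.
Qed.

(** * Components of nearly 2-regular graphs *)

Lemma maximal_path (H : sgraph) (x : H) :
  exists2 s, path (@adj H) x s && uniq (x :: s) &
    forall y, adj (last x s) y -> y \in x :: s.
Proof.
suff extend n s : path (@adj H) x s && uniq (x :: s) -> #|H| <= size s + n ->
    exists2 s, path (@adj H) x s && uniq (x :: s) &
      forall y, adj (last x s) y -> y \in x :: s.
  by apply: (extend #|H| [::]).
elim: n s => [|n IHn] s /andP[ps us] sz.
  have : size (x :: s) <= #|H|.
    by rewrite cardE; apply: uniq_leq_size us _ => y _; rewrite mem_enum.
  by move/leq_trans/(_ sz); rewrite addn0 ltnn.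
case: (pickP (fun y => adj (last x s) y && (y \notin x :: s))) => [y /andP[ay yns]|nops].
  apply: (IHn (rcons s y)); last by rewrite size_rcons; lia.
  by rewrite rcons_path ps ay -rcons_cons rcons_uniq yns us.
exists s; first by rewrite ps us.
by move=> y ay; have := nops y; rewrite ay => /negbFE.
Qed.

(** Let X_0, ..., X_m be a maximal path from x.  Its last vertex has degree at
    least 2, so it has a neighbour X_j other than X_(m-1), and by maximality
    j < m - 1: the path carries at least the edges of a lollipop L(m+1-j, j).
    Comparing degrees, X_j is the vertex of degree 3, or j = 0 if all degrees
    are 2, so every vertex of the path has no neighbours besides those. *)
Lemma lollipop_component (H : sgraph) (x : H) :
  (forall z : H, deg z = 2)
  \/ deg x = 1 /\ (exists2 w : H, deg w = 3 & forall z, z != x -> z != w -> deg z = 2) ->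
  exists q j (h : 'I_(j + q) -> H),
    [/\ 2 < q, injective h, forall i t, adj (h i) (h t) = lollipop_rel q j i t
      & forall i y, adj (h i) y -> y \in codom h]
    /\ ((forall z : H, deg z = 2) -> j = 0) /\ (forall y, y \notin codom h -> deg y = 2).
Proof.
move=> degs; have [s /andP[ps us] max_s] := maximal_path x.
have deg_gt0 : 0 < deg x by case: degs => [->|[-> _]].
have deg_ge2 z : z != x -> 1 < deg z.
  by case: degs => [->|[_ [w dw dz]]] // zx; case: (eqVneq z w) => [->|/dz->]; rewrite ?dw.
set X := nth x (x :: s); set m := size s.
have X0 : X 0 = x by [].
have Xm : X m = last x s by rewrite /X /m nth_last.
have adjX i : i < m -> adj (X i) (X i.+1) by move/pathP: ps => /(_ x i).
have injX i j : i <= m -> j <= m -> X i = X j -> i = j.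
  by move=> im jm /eqP; rewrite nth_uniq // => /eqP.
have memX y : y \in x :: s -> exists2 i, i <= m & y = X i.
  move=> ys; exists (index y (x :: s)); last by rewrite /X nth_index.
  by have := ys; rewrite -index_mem.
have m_gt0 : 0 < m.
  rewrite lt0n; apply/negP=> /eqP m0; move: deg_gt0; rewrite /deg.
  case/card_gt0P=> y; rewrite inE => xy; have := max_s y.
  rewrite -Xm m0 X0 xy => /(_ isT) /memX[i]; rewrite m0 leqn0 => /eqP-> yx.
  by rewrite yx adj_irrefl in xy.
have [j j_lt ajm] : exists2 j, j.+1 < m & adj (X m) (X j).
  have Xmx : X m != x by apply/eqP; rewrite -X0 => /injX; lia.
  have /card_gt1P[y [y' []]] := deg_ge2 _ Xmx; rewrite !inE => ay ay' ne_yy'.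
  have [z az nz] : exists2 z, adj (X m) z & z != X m.-1.
    case: (eqVneq y (X m.-1)) => [yE|]; last by exists y.
    by exists y' => //; rewrite -yE eq_sym.
  have /memX[i im zi] : z \in x :: s by apply: max_s; rewrite -Xm.
  subst z; exists i => //.
  have : i != m by apply: contraTneq az => ->; rewrite adj_irrefl.
  have : i != m.-1 by apply: contraNneq nz => ->.
  by move: im; lia.
pose q := m.+1 - j; have p3 : 2 < q by rewrite /q; lia.
have jqE : j + q = m.+1 by rewrite /q; lia.
pose h (i : 'I_(j + q)) := X i.
have ord_le (i : 'I_(j + q)) : i <= m by rewrite -ltnS -jqE ltn_ord.
have inj_h : injective h.
  by move=> i t /injX eq_it; apply: val_inj; apply: eq_it.
have sub_adjX a b : a <= m -> b <= m -> lollipop_rel q j a b -> adj (X a) (X b).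
  move=> am bm; rewrite /lollipop_rel /path_rel jqE /= => /orP[/orP[/orP[]|]|].
  - by move=> /eqP ba; rewrite ba adjX // -ba.
  - by move=> /eqP ab; rewrite ab adj_sym adjX // -ab.
  - by move=> /andP[/eqP-> /eqP->]; rewrite adj_sym.
  - by move=> /andP[/eqP-> /eqP->].
have sub_adj (i t : 'I_(j + q)) : lollipop_rel q j i t -> adj (h i) (h t).
  exact: sub_adjX.
(* N i is the set of those neighbours of [h i] that the lollipop accounts for. *)
pose N i := [set h t | t in [pred t : 'I_(j + q) | lollipop_rel q j i t]].
have card_N (i : 'I_(j + q)) : #|N i| + (i == 0 :> nat) = 2 + (i == j :> nat).
  rewrite card_imset // -(lollipop_rel_deg p3 (ltn_ord i)) -sum1_card big_mkcond.
  by congr (_ + _); apply: eq_bigr=> t _; rewrite !inE; case: lollipop_rel.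
have sub_N (i : 'I_(j + q)) : N i \subset [set y | adj (h i) y].
  by apply/subsetP=> y /imsetP[t it ->]; rewrite !inE in it *; apply: sub_adj.
have N_le_deg (i : 'I_(j + q)) : #|N i| <= deg (h i) by apply: subset_leq_card.
have lt0 : 0 < j + q by lia.
have ltj : j < j + q by lia.
pose i0 := Ordinal lt0; pose ij := Ordinal ltj.
have hi0 : h i0 = x by [].
have [degs_h [deg_out j0]] : (forall i, deg (h i) <= #|N i|)
    /\ (forall y, y \notin codom h -> deg y = 2) /\ ((forall z : H, deg z = 2) -> j = 0).
  have all2 : (forall z : H, deg z = 2) -> j = 0.
    by move=> deg2; have := N_le_deg ij; have := card_N ij; rewrite deg2 /= eqxx; lia.
  case: degs => [deg2|[degx [w dw deg_z]]].
    split=> [i|]; last by [].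
    by rewrite deg2; have := card_N i; have := all2 deg2; lia.
  have j_gt0 : 0 < j.
    by have := N_le_deg i0; have := card_N i0; rewrite hi0 degx /=; lia.
  have ij_x : h ij != x by rewrite -hi0 (inj_eq inj_h) -val_eqE /=; lia.
  have hij : h ij = w.
    apply/eqP/negPn/negP=> hij; have := N_le_deg ij; have := card_N ij.
    by rewrite deg_z //= eqxx; lia.
  split=> [i|]; last split=> //.
    have := card_N i; case: (eqVneq i i0) => [-> /=|ne0]; first by rewrite hi0 degx; lia.
    case: (eqVneq i ij) => [-> /=|nej]; first by rewrite hij dw eqxx; lia.
    rewrite deg_z -?hi0 -?hij ?(inj_eq inj_h) //.
    by move: ne0 nej; rewrite -!val_eqE /=; lia.
  move=> y yout; apply: deg_z; apply: contraNneq yout => ->.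
    by rewrite -hi0 codom_f.
  by rewrite -hij codom_f.
have NE (i : 'I_(j + q)) : N i = [set y | adj (h i) y].
  by apply/eqP; rewrite eqEcard sub_N degs_h.
exists q, j, h; split; last by split.
split=> // [i t|i y].
  apply/idP/idP => [it|]; last exact: sub_adj.
  have : h t \in N i by rewrite NE inE.
  by case/imsetP=> t'; rewrite inE => rt' /inj_h->.
by move=> iy; have : y \in N i; [rewrite NE inE | case/imsetP=> t _ ->; apply: codom_f].
Qed.

(** * Lollipops are determined by their characteristic polynomial *)

Local Open Scope ring_scope.

Lemma det_lollipop_rel p k : (2 < p)%N ->
  \det (nat_mx (k + p) (char_entry ('X : {poly algC}) (lollipop_rel p k))) =
  lollipop_poly algC p k.
Proof. by case: p => [|[|[|m]]] // _; rewrite det_lollipop. Qed.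

Lemma lollipop_graph_poly p k G : (2 < p)%N -> is_lollipop p k G ->
  graph_poly G = lollipop_poly algC p k.
Proof.
move=> p3 LG; have card_G := lollipop_card LG; case: LG => h bij_h adjE.
by rewrite (graph_poly_nat_mx (bij_inj bij_h) (esym card_G) adjE) det_lollipop_rel.
Qed.

(** If no edge leaves the image of h, the matrix is block diagonal.  The
    complement is then a 2-regular graph, and if it is not empty its all-ones
    vector is an eigenvector for 2. *)
Lemma closed_part_factor (H : sgraph) n (h : 'I_n -> H) (e : rel nat) :
  injective h -> (forall i j, adj (h i) (h j) = e i j) ->
  (forall i y, adj (h i) y -> y \in codom h) ->
  (forall y, y \notin codom h -> deg y = 2%N) ->
  exists2 r, graph_poly H = \det (nat_mx n (char_entry 'X e)) * r &
    n = #|H| \/ root r 2%:R.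
Proof.
move=> inj_h adjE closed_h deg_out.
pose C := [set y | y \notin codom h].
pose hh (i : 'I_(n + #|C|)) :=
  match split i with inl a => h a | inr b => enum_val b end.
have hh_l a : hh (lshift _ a) = h a by rewrite /hh (unsplitK (inl _ a)).
have hh_r b : hh (rshift _ b) = enum_val b by rewrite /hh (unsplitK (inr _ b)).
have val_out (b : 'I_#|C|) : enum_val b \notin codom h.
  by have := enum_valP b; rewrite inE.
have inj_hh : injective hh.
  move=> i j; rewrite -(splitK i) -(splitK j).
  case: (split i) => a; case: (split j) => b /=; rewrite ?hh_l ?hh_r.
  - by move/inj_h->.
  - by move=> eq_ab; have := val_out b; rewrite -eq_ab codom_f.
  - by move=> eq_ab; have := val_out a; rewrite eq_ab codom_f.
  - by move/enum_val_inj->.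
have card_H : (n + #|C| = #|H|)%N.
  have -> : #|C| = #|[predC codom h]| by apply: eq_card=> y; rewrite !inE.
  by rewrite -(cardC (mem (codom h))) (card_codom inj_h) card_ord.
pose B : 'M[algC]_#|C| := \matrix_(i, j) (adj (enum_val i) (enum_val j))%:R.
have out_adj (b : 'I_#|C|) i : adj (h i) (enum_val b) = false.
  by apply/negP=> /closed_h; apply/negP.
exists (char_poly B).
- rewrite (graph_poly_reindex inj_hh card_H) /char_poly.
  set M := char_poly_mx _; rewrite -[M]submxK.
  have -> : ursubmx M = 0.
    apply/matrixP=> i j; rewrite !mxE hh_l hh_r out_adj.
    by rewrite eq_lrshift mulr0n subr0.
  rewrite det_lblock; congr (_ * _); congr (\det _); apply/matrixP=> i j; rewrite !mxE.
    by rewrite !hh_l adjE /char_entry eq_lshift polyC_natr.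
  by rewrite !hh_r eq_rshift.
- case: (posnP #|C|) => [C0|C_gt0]; [by left; rewrite -card_H C0 addn0 | right].
  rewrite -eigenvalue_root_char; apply/eigenvalueP; exists (const_mx 1).
    apply/rowP=> j; rewrite !mxE mulr1.
    under eq_bigr do rewrite !mxE mul1r.
    transitivity (\sum_(y in C) (adj y (enum_val j))%:R : algC).
      by rewrite [RHS]big_enum_val.
    rewrite -(deg_out _ (val_out j)) degE natr_sum big_mkcond /=.
    apply: eq_bigr=> y _; rewrite adj_sym inE; case: ifP => // /negbFE/codomP[i ->].
    by rewrite adj_sym out_adj.
  apply/eqP=> /rowP/(_ (Ordinal C_gt0)); rewrite !mxE; apply/eqP; exact: oner_neq0.
Qed.

Lemma cospectral_lollipop_poly p k (G H : sgraph) : (4 < p)%N ->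
  is_lollipop p k G -> graph_poly H = graph_poly G -> is_lollipop p k H.
Proof.
move=> p5 LG eqHG; have p3 : (2 < p)%N by lia.
have card_HG := graph_poly_card eqHG.
have polyH : graph_poly H = lollipop_poly algC p k by rewrite eqHG (lollipop_graph_poly p3 LG).
have degs := cospectral_lollipop_degrees LG p5 eqHG.
have H_gt0 : (0 < #|H|)%N by rewrite card_HG (lollipop_card LG); lia.
have [x0 _] := card_gt0P H_gt0.
have [x [degs_x deg2k]] : exists x : H, ((forall z : H, deg z = 2%N)
  \/ deg x = 1%N /\ (exists2 w : H, deg w = 3%N & forall z, z != x -> z != w -> deg z = 2%N))
  /\ (k = 0%N -> forall z : H, deg z = 2%N).
  case: degs => [deg2|[k_gt0 [u [w [du dw dz]]]]]; first by exists x0; split; [left|].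
  by exists u; split; [right; split=> //; exists w | lia].
have [q [j [h [[q3 inj_h adjE closed_h] [j0 deg_out]]]]] := lollipop_component degs_x.
have [r polyE r2] := closed_part_factor inj_h adjE closed_h deg_out.
rewrite polyH det_lollipop_rel // in polyE.
have eq_n : (j + q = #|H|)%N.
  (* A non-empty complement contributes a factor vanishing at 2: impossible if
     k > 0, and if k = 0 it would make 2 a double root. *)
  case: r2 => // /rootP r2; exfalso; case: (posnP k) => [k0|k_gt0]; last first.
    have /eqP : (lollipop_poly algC p k).[2%:R] = 0 by rewrite polyE hornerM r2 mulr0.
    by rewrite lollipop_poly_horner2 ?(ltnW p3) // oppr_eq0 pnatr_eq0; lia.
  have jz := j0 (deg2k k0); move: polyE; rewrite k0 => polyE.
  have /eqP := cycle_poly_deriv2 algC (ltnW p3).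
  rewrite polyE derivM hornerD !hornerM r2 lollipop_poly_horner2 ?(ltnW q3) //.
  rewrite jz muln0 oppr0 mul0r mulr0 addr0 mulr0 eq_sym pnatr_eq0; lia.
have LH : is_lollipop q j H.
  by exists h => //; apply: inj_card_bij => //; rewrite card_ord eq_n.
have eq_kp : (k + p = j + q)%N by rewrite -(lollipop_card LG) -card_HG.
have eq_poly : lollipop_poly algC p k = lollipop_poly algC q j.
  by rewrite -polyH (lollipop_graph_poly q3 LH).
have eq_pq := lollipop_poly_inj p3 q3 eq_kp eq_poly.
have eq_kj : k = j by lia.
by rewrite eq_kj eq_pq.
Qed.

Local Close Scope ring_scope.

Lemma is_lollipop_isomorphic p k (G H : sgraph) :
  is_lollipop p k G -> is_lollipop p k H -> isomorphic H G.
Proof.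
move=> [g bij_g adjG] [h [h' hK h'K] adjH]; exists (g \o h').
  by apply: bij_comp bij_g _; exists h.
by move=> x y; rewrite /= adjG -adjH !h'K.
Qed.


(** * Labelling the lollipop, and the theorem *)

Lemma modnS_small p a : a < p -> a.+1 %% p = if a == p.-1 then 0 else a.+1.
Proof.
move=> a_lt; case: eqP => [->|ne]; first by rewrite prednK ?modnn; lia.
by rewrite modn_small; lia.
Qed.

Lemma cycle_adjE p (i j : 'I_p) : 2 < p -> cycle_adj i j = lollipop_rel p 0 i j.
Proof.
move=> p3; rewrite /lollipop_rel /path_rel /cycle_adj -!val_eqE /= add0n.
rewrite !modnS_small ?ltn_ord //.
have := ltn_ord i; have := ltn_ord j; move: (i : nat) (j : nat) => a b.
by do 2!case: ifP => ?; do ?[case: eqP => ? /=]; lia.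
Qed.

Lemma cycle_is_lollipop p : 2 < p -> is_lollipop p 0 (cycle_graph p).
Proof.
move=> p3; exists (fun i : 'I_(0 + p) => i : cycle_graph p); first by exists id.
by move=> i j; apply: cycle_adjE.
Qed.

(** The vertex at distance d from v on the path gets the number k - d, and the
    cycle is numbered from k on, starting at v, whatever v is. *)
Lemma lollipop_is_lollipop p k (v : cycle_graph p) : 2 < p -> is_lollipop p k (lollipop k v).
Proof.
move=> p3; case: k => [|k]; first exact: cycle_is_lollipop.
pose pos (a : lollipop k.+1 v) : nat :=
  match a with inl x => k.+1 + (x + (p - v)) %% p | inr y => k.+1 - val y end.
have p_gt0 : 0 < p by lia.
have v_lt : v < p := ltn_ord v.
have modE (x : 'I_p) : (x + (p - v)) %% p = if v <= x then x - v else x + p - v.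
  have := ltn_ord x; case: ifP => vx xp; last by rewrite modn_small; lia.
  by rewrite (_ : x + (p - v) = x - v + p) ?modnDr ?modn_small; lia.
have tail_gt0 (y : path_graph k.+2) : y != ord0 -> 0 < y by rewrite lt0n.
have pos_lt a : pos a < k.+1 + p.
  case: a => [x|[y yP]] /=; first by rewrite ltn_add2l ltn_mod.
  by lia.
pose g a := Ordinal (pos_lt a).
have inj_g : injective g.
  move=> a b /(congr1 val) /=; case: a => [x|[y yP]]; case: b => [x'|[y' y'P]] /=.
  - rewrite !modE => eq_xx'; congr inl; apply: val_inj => /=.
    by move: eq_xx'; have := ltn_ord x; have := ltn_ord x'; do 2!case: ifP; lia.
  - by move=> eq_pos; exfalso; have := tail_gt0 _ y'P; lia.
  - by move=> eq_pos; exfalso; have := tail_gt0 _ yP; lia.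
  - move=> eq_yy'; congr inr; apply: val_inj; apply: val_inj => /=.
    by have := ltn_ord y; have := ltn_ord y'; lia.
have bij_g : bijective g.
  apply: inj_card_bij => //; rewrite card_ord card_sum card_ord card_sig.
  by rewrite cardC1 card_ord; lia.
case: bij_g => g' gK g'K; exists g'; first by exists g.
have adj_g a b : adj a b = lollipop_rel p k.+1 (g a) (g b).
  rewrite /g /=; case: a => [x|[y yP]]; case: b => [x'|[y' y'P]] /=.
  - rewrite /cycle_adj -!val_eqE /= !modnS_small ?ltn_ord // !modE.
    rewrite /lollipop_rel /path_rel addSn /=.
    have := ltn_ord x; have := ltn_ord x'; move: (x : nat) (x' : nat) (v : nat) v_lt => a b c.
    by do 4!case: ifP => ?; do ?[case: eqP => ? /=]; lia.
  - have := tail_gt0 _ y'P; have := ltn_ord x; have := ltn_ord y'; rewrite modE.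
    rewrite /lollipop_rel /path_rel addSn /= /path_adj -val_eqE /=.
    move: (x : nat) (y' : nat) (v : nat) v_lt => a b c.
    by case: ifP => ?; do ?[case: eqP => ? /=]; lia.
  - have := tail_gt0 _ yP; have := ltn_ord x'; have := ltn_ord y; rewrite modE.
    rewrite /lollipop_rel /path_rel addSn /= /path_adj -val_eqE /=.
    move: (x' : nat) (y : nat) (v : nat) v_lt => a b c.
    by case: ifP => ?; do ?[case: eqP => ? /=]; lia.
  - have := tail_gt0 _ yP; have := tail_gt0 _ y'P; have := ltn_ord y; have := ltn_ord y'.
    rewrite /lollipop_rel /path_rel addSn /= /path_adj /=.
    move: (y : nat) (y' : nat) => a b.
    by do ?[case: eqP => ? /=]; lia.
by move=> i j; rewrite adj_g !g'K.
Qed.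

Theorem theorem20 (p k : nat) (v : cycle_graph p) :
  6 <= p -> ~~ odd p -> determined_by_spectrum (lollipop k v).
Proof.
move=> p6 _ H cospHL.
have LG := lollipop_is_lollipop k v (leq_trans (isT : 2 < 6) p6).
apply: (is_lollipop_isomorphic LG).
exact: cospectral_lollipop_poly (ltnW p6) LG (cospectral_graph_poly cospHL).
Qed.
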